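(* Let $M$ be a smooth manifold and $(\tau,\omega)$ a pair of a 1-form and a 2-form on $M$ whose class is $\ge 3$ at every point. The following statements are equivalent: (i) The extended 3-form $\tau\wedge\omega$ is almost-multisymplectic. (ii) $\tau$ is nowhere-vanishing and the extended characteristic distribution $\mathcal X_{(\tau,\omega)}$ is zero. (iii) $M$ is odd-dimensional and the class of the pair $(\tau,\omega)$ is equal to this dimension.
   Context: For a $p$-form $\alpha$, $\operatorname{Ker}\alpha_x=\{v\in T_xM\mid\iota_v\alpha_x=0\}$. A $p$-form $\alpha$ is almost-multisymplectic if for every $x\in M$ the map $T_xM\to\bigwedge^{p-1}T_x^*M$, $v\mapsto\iota_v\alpha_x$, is injective. The class of $(\tau,\omega)$ at $x$ is the codimension in $T_xM$ of $\operatorname{Ker}\tau_x\cap\operatorname{Ker}\omega_x$. The extended characteristic distribution at $x$ is $\mathcal X_{(\tau,\omega)_x}=\{v\in\operatorname{Ker}\tau_x\mid\iota_v\omega_x=a\,\tau_x\text{ for some }a\in\mathbb R\}$. *)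

(* Defs.v *)
From HB Require Import structures.
From mathcomp Require Import all_boot all_order all_algebra fingroup perm.
From mathcomp Require Import all_classical all_reals all_analysis.

Set Implicit Arguments.
Unset Strict Implicit.
Unset Printing Implicit Defensive.

Import Order.TTheory GRing.Theory Num.Theory numFieldNormedType.Exports.

Local Open Scope classical_set_scope.
Local Open Scope ring_scope.

Section AlternatingForms.
Context {R : numFieldType} {V : lmodType R}.
Implicit Types p q : nat.

Definition multilinear p (f : ('I_p -> V) -> R^o) : Prop :=
  forall (i : 'I_p) (v : 'I_p -> V), linear (fun x => f [eta v with i |-> x]).

Definition alternate p (f : ('I_p -> V) -> R^o) : Prop :=
  forall (v : 'I_p -> V) (i j : 'I_p), i != j -> v i = v j -> f v = 0.

Definition altform_pred p : {pred ('I_p -> V) -> R^o} :=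
  fun f => `[< multilinear f /\ alternate f >].

Lemma altform_submod_closed p : submod_closed (@altform_pred p).
Proof.
split=> [|a f g].
  apply/asboolP; split=> [i v b x y|//].
  by rewrite /= /GRing.zero /= scaler0 addr0.
move=> /asboolP[fl fa] /asboolP[gl ga]; apply/asboolP; split=> [i v b x y|v i j ij vij].
  have E h : (a *: f + g) h = a *: f h + g h by [].
  rewrite !E fl gl !scalerDr !scalerA (mulrC a b) -!addrA; congr (_ + _).
  by rewrite addrCA.
have E h : (a *: f + g) h = a *: f h + g h by [].
by rewrite E (fa _ _ _ ij vij) (ga _ _ _ ij vij) scaler0 addr0.
Qed.

HB.instance Definition _ p := GRing.isSubmodClosed.Build R
  (('I_p -> V) -> R^o) (@altform_pred p) (altform_submod_closed p).

Record altform p := AltForm {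
  altform_fun :> ('I_p -> V) -> R^o;
  altform_funP : altform_fun \in @altform_pred p }.

HB.instance Definition _ p := [isSub for @altform_fun p].
HB.instance Definition _ p := [Choice of altform p by <:].
HB.instance Definition _ p := [SubChoice_isSubLmodule of altform p by <:].


Lemma altform_multilinear p (a : altform p) : multilinear a.
Proof. by case: a => f fP; have /asboolP[] := fP. Qed.

Lemma altform_alternate p (a : altform p) : alternate a.
Proof. by case: a => f fP; have /asboolP[] := fP. Qed.

Definition consv p (x : V) (v : 'I_p -> V) : 'I_p.+1 -> V :=
  fun i => oapp v x (unlift ord0 i).

Definition intprod_fun p (x : V) (a : altform p.+1) : ('I_p -> V) -> R^o :=
  fun v => a (consv x v).

Lemma intprod_subproof p (x : V) (a : altform p.+1) :
  intprod_fun x a \in @altform_pred p.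
Proof.
apply/asboolP; split=> [i v b y z|v i j ij vij].
  have E t : consv x [eta v with i |-> t] =
             [eta consv x v with lift ord0 i |-> t].
    apply/funext => k; rewrite /consv /=.
    case: (unliftP ord0 k) => [k' ->|->] /=; last by [].
    by rewrite (inj_eq lift_inj).
  by rewrite /intprod_fun !E altform_multilinear.
apply: (@altform_alternate _ a _ (lift ord0 i) (lift ord0 j)).
  by rewrite (inj_eq lift_inj).
by rewrite /consv !liftK.
Qed.

(* intprod x a is the interior product of x and a, with x in the first slot. *)
Definition intprod p (x : V) (a : altform p.+1) : altform p :=
  AltForm (intprod_subproof x a).

(* (1 / p!q!) sum_s sgn(s) a(v_s(1), ..., v_s(p)) b(v_s(p+1), ..., v_s(p+q)) *)
Definition wedge_fun p q (a : altform p) (b : altform q) :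
    ('I_(p + q) -> V) -> R^o :=
  fun v => (p`! * q`!)%:R^-1 * \sum_(s : 'S_(p + q)) (-1) ^+ s *
    ((a (fun i => v (s (lshift q i))) : R) *
     (b (fun j => v (s (rshift p j))) : R)) : R.

Lemma wedge_subproof p q (a : altform p) (b : altform q) :
  wedge_fun a b \in @altform_pred (p + q).
Proof.
apply/asboolP; split=> [k v c y z|v i j ij vij]; rewrite /wedge_fun.
  have sumE (K S S1 S2 : R) : S = c * S1 + S2 ->
      K * S = c *: (K * S1 : R^o) + K * S2 :> R^o.
    by move=> ->; rewrite mulrDr mulrCA.
  apply: sumE; rewrite mulr_sumr -big_split /=; apply: eq_bigr => s _.
  rewrite [c * _]mulrCA -mulrDr; congr (_ * _).
  have scE (t u : R^o) : c *: t + u = c * (t : R) + (u : R) :> R by [].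
  have [k' Ek] : exists k', k = s k' by exists (s^-1 k)%g; rewrite permKV.
  rewrite {}Ek; case: (split_ordP k') => {k'} [l|r] ->.
    have El t : (fun i => [eta v with s (lshift q l) |-> t] (s (lshift q i))) =
        [eta (fun i => v (s (lshift q i))) with l |-> t].
      by apply/funext => i /=; rewrite (inj_eq perm_inj) eq_lshift.
    have Er t : (fun j => [eta v with s (lshift q l) |-> t] (s (rshift p j))) =
        (fun j => v (s (rshift p j))).
      by apply/funext => j /=; rewrite (inj_eq perm_inj) eq_rlshift.
    by rewrite !El !Er altform_multilinear scE mulrDl mulrA.
  have Er t : (fun i => [eta v with s (rshift p r) |-> t] (s (rshift p i))) =
      [eta (fun i => v (s (rshift p i))) with r |-> t].
    by apply/funext => i /=; rewrite (inj_eq perm_inj) eq_rshift.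
  have El t : (fun j => [eta v with s (rshift p r) |-> t] (s (lshift q j))) =
      (fun j => v (s (lshift q j))).
    by apply/funext => j /=; rewrite (inj_eq perm_inj) eq_lrshift.
  by rewrite !El !Er altform_multilinear scE mulrDr mulrCA.
set S := (X in _ * X); suff -> : S = 0 by rewrite mulr0.
suff /eqP : S = - S by rewrite -addr_eq0 -mulr2n mulrn_eq0 /= => /eqP.
have vt k : v (tperm i j k) = v k by case: tpermP => // ->.
rewrite [in LHS]/S (reindex_inj (mulIg (tperm i j))) /= -sumrN.
apply: eq_bigr => s _; rewrite odd_permM odd_tperm ij addbT.
rewrite signrN mulNr; congr (- _); congr (_ * _).
have E k : v ((s * tperm i j)%g k) = v (s k) by rewrite permM vt.
by congr (_ * _); congr (altform_fun _ _); apply/funext => l; rewrite E.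
Qed.

Definition wedge p q (a : altform p) (b : altform q) : altform (p + q) :=
  AltForm (wedge_subproof a b).

End AlternatingForms.
Arguments altform {R} V p.

Section Kernel.
Context {R : numFieldType} {V : vectType R}.

Lemma intprod_linear p (a : altform V p.+1) : linear (fun x => intprod x a).
Proof.
move=> c x y; apply/val_inj/funext => v /=.
rewrite /intprod_fun.
have E t : consv t v = [eta consv 0 v with ord0 |-> t].
  apply/funext => k; rewrite /consv /=.
  by case: (unliftP ord0 k) => [k' ->|->] //=; rewrite ?liftK.
by rewrite (E (c *: x + y)) altform_multilinear -!E.
Qed.

Lemma Ker_subproof p (a : altform V p.+1) :
  exists U : {vspace V}, forall x, (x \in U) = `[< intprod x a = 0 >].
Proof.
pose P d := `[< exists2 U : {vspace V},
  (forall x, x \in U -> intprod x a = 0) & \dim U = d >].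
have c0 : intprod 0 a = 0.
  by have := intprod_linear a (-1) 0 0; rewrite !scaleN1r !addNr.
have P0 : exists d, P d.
  exists 0%N; apply/asboolP; exists 0%VS; last by rewrite dimv0.
  by move=> x; rewrite memv0 => /eqP ->.
have Pb d : P d -> (d <= \dim {:V})%N.
  by move=> /asboolP[U _ <-]; rewrite dimvS ?subvf.
case: (ex_maxnP P0 Pb) => d /asboolP[U UK dU] dmax; exists U => x.
apply/idP/asboolP => [|cx]; first exact: UK.
have : P (\dim (U + <[x]>)%VS).
  apply/asboolP; exists (U + <[x]>)%VS => // _ /memv_addP[u uU [w /vlineP[k ->] ->]].
  by rewrite addrC intprod_linear (UK _ uU) cx scaler0 addr0.
move=> /dmax; rewrite -dU => dle.
have /eqP E : U == (U + <[x]>)%VS by rewrite eqEdim addvSl.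
by rewrite E memvE addvSr.
Qed.

(* Classical choice only packages the set {x | intprod x a = 0} as a subspace;
   see mem_Ker. *)
Definition Ker p (a : altform V p.+1) : {vspace V} := sval (cid (Ker_subproof a)).

Lemma mem_Ker p (a : altform V p.+1) (x : V) :
  x \in Ker a <-> intprod x a = 0.
Proof. by rewrite /Ker; case: cid => U /= ->; split=> /asboolP. Qed.

Definition codim (U : {vspace V}) : nat := (\dim {:V} - \dim U)%N.

End Kernel.

Section Smooth.
Context {R : numFieldType} {V W : normedModType R}.

Fixpoint iter_derive (vs : seq V) (f : V -> W) : V -> W :=
  if vs is v :: vs' then fun x => 'D_v (iter_derive vs' f) x else f.

(* For open U this is C^infinity: all iterated directional derivatives exist
   and are Frechet differentiable, hence continuous, on U. *)
Definition smooth_on (U : set V) (f : V -> W) : Prop :=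
  forall (vs : seq V) (x : V), U x -> differentiable (iter_derive vs f) x.

End Smooth.

Lemma diff_comp_near (R : numFieldType) (V : normedModType R) (f g h : V -> V)
    (a b w : V) :
  f a = b -> differentiable f a -> differentiable g b -> differentiable h a ->
  (\near a, h a = g (f a)) -> 'd h a w = 'd g b ('d f a w).
Proof.
move=> <- df dg dh hgf.
rewrite -[RHS](congr1 (fun k : V -> V => k w) (diff_comp df dg)).
rewrite -!deriveE //; last exact: differentiable_comp.
exact: near_eq_derive.
Qed.

(* [chart_map] and [chart_inv] are total; their values outside [chart_dom] and
   its image are irrelevant. *)
Record chart (R : realType) (n : nat) (M : topologicalType) := Chart {
  chart_dom : set M;
  chart_map :> M -> 'rV[R]_n;
  chart_inv : 'rV[R]_n -> M;
  chart_dom_open : open chart_dom;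
  chart_cod_open : open (chart_map @` chart_dom);
  chart_mapK : {in chart_dom, cancel chart_map chart_inv};
  chart_map_continuous : {in chart_dom, continuous chart_map};
  chart_inv_continuous : {in chart_map @` chart_dom, continuous chart_inv} }.

(* The atlas need not be maximal: tangent vectors and smoothness of forms do not
   change when compatible charts are added. *)
Record smooth_manifold (R : realType) (n : nat) := SmoothManifold {
  manifold_space :> topologicalType;
  manifold_hausdorff : hausdorff_space manifold_space;
  manifold_second_countable : @second_countable manifold_space;
  atlas : set (chart R n manifold_space);
  atlas_cover : forall x, exists2 phi, atlas phi & chart_dom phi x;
  atlas_smooth : forall phi psi, atlas phi -> atlas psi ->
    smooth_on (phi @` (chart_dom phi `&` chart_dom psi))
              (psi \o chart_inv phi) }.

Section TangentSpace.
Context {R : realType} {n : nat} {M : smooth_manifold R n}.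
Implicit Type x : M.

Definition charts_at x : set (chart R n M) :=
  [set phi | atlas phi /\ chart_dom phi x].

(* A tangent vector at x is the family of its coordinates in all charts around
   x, related by the differentials of the transition maps. *)
Definition tangent_pred x : {pred charts_at x -> 'rV[R]_n} := fun v =>
  `[< forall c d : charts_at x,
      v d = 'd (val d \o chart_inv (val c)) (val c x) (v c) >].

Lemma tangent_submod_closed x : submod_closed (@tangent_pred x).
Proof.
split=> [|a u v /asboolP uP /asboolP vP]; apply/asboolP => c d.
  by rewrite [in RHS](_ : 0 c = 0) ?linear0.
have E (e : charts_at x) : (a *: u + v) e = a *: u e + v e by [].
by rewrite !E linearP -uP -vP.
Qed.

HB.instance Definition _ x := GRing.isSubmodClosed.Build R
  (charts_at x -> 'rV[R]_n) (@tangent_pred x) (tangent_submod_closed x).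

Record tangent x := Tangent {
  tangent_coord :> charts_at x -> 'rV[R]_n;
  tangent_coordP : tangent_coord \in @tangent_pred x }.

HB.instance Definition _ x := [isSub for @tangent_coord x].
HB.instance Definition _ x := [Choice of tangent x by <:].
HB.instance Definition _ x := [SubChoice_isSubLmodule of tangent x by <:].

Lemma charts_atP x (c : charts_at x) : atlas (val c) /\ chart_dom (val c) x.
Proof. by case: c => c /= /set_mem. Qed.

Lemma charts_at_chosen x : charts_at x.
Proof.
have /cid2[phi pa px] := atlas_cover x.
by exists phi; rewrite inE; split.
Defined.

Lemma transition_differentiable x (c d : charts_at x) :
  differentiable (val d \o chart_inv (val c)) (val c x).
Proof.
have [ca cx] := charts_atP c; have [da dx] := charts_atP d.
by apply: (@atlas_smooth _ _ _ _ _ ca da [::]); exists x.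
Qed.

Lemma near_chart x (c d : charts_at x) : \forall y \near val c x,
  chart_dom (val c) (chart_inv (val c) y) /\
  val c (chart_inv (val c) y) = y /\ chart_dom (val d) (chart_inv (val c) y).
Proof.
have [ca cx] := charts_atP c; have [da dx] := charts_atP d.
have cxi : (val c @` chart_dom (val c)) (val c x) by exists x.
have near1 : nbhs (val c x) (val c @` chart_dom (val c)).
  by apply: open_nbhs_nbhs; split=> //; exact: chart_cod_open.
have cinv : {for val c x, continuous (chart_inv (val c))}.
  by apply: chart_inv_continuous; rewrite inE.
have near2 : nbhs (chart_inv (val c) (val c x)) (chart_dom (val d)).
  rewrite chart_mapK ?inE //.
  by apply: open_nbhs_nbhs; split=> //; exact: chart_dom_open.
move: near1 (cinv _ near2) => /=; apply: filterS2 => _ [z zc <-] /= dz.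
by move: dz; rewrite chart_mapK ?inE.
Qed.

Lemma transition_comp x (c d e : charts_at x) (w : 'rV[R]_n) :
  'd (val e \o chart_inv (val c)) (val c x) w =
  'd (val e \o chart_inv (val d)) (val d x)
    ('d (val d \o chart_inv (val c)) (val c x) w).
Proof.
have [ca cx] := charts_atP c.
apply: diff_comp_near.
- by rewrite /= chart_mapK ?inE.
- exact: transition_differentiable.
- exact: transition_differentiable.
- exact: transition_differentiable.
by apply: filterS (near_chart c d) => y [_ [_ dy]]; rewrite /= chart_mapK ?inE.
Qed.

Lemma transition_id x (c : charts_at x) (w : 'rV[R]_n) :
  'd (val c \o chart_inv (val c)) (val c x) w = w.
Proof.
rewrite -deriveE; last exact: transition_differentiable.
rewrite -[RHS](derive_id (val c x)); apply: near_eq_derive.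
by apply: filterS (near_chart c c) => y [_ [yy _]]; rewrite /= yy.
Qed.

Lemma tangent_of_subproof x (c : charts_at x) (w : 'rV[R]_n) :
  (fun d : charts_at x => 'd (val d \o chart_inv (val c)) (val c x) w)
    \in @tangent_pred x.
Proof. apply/asboolP => d e; exact: (transition_comp c d e w). Qed.

Definition tangent_of x (c : charts_at x) (w : 'rV[R]_n) : tangent x :=
  Tangent (tangent_of_subproof c w).

Lemma tangent_ofK x (c : charts_at x) :
  cancel (tangent_of c) (fun v : tangent x => v c).
Proof. by move=> w; rewrite /= transition_id. Qed.

Lemma tangent_coordK x (c : charts_at x) :
  cancel (fun v : tangent x => v c) (tangent_of c).
Proof.
move=> v; apply/val_inj/funext => d /=.
by have /asboolP vP := tangent_coordP v; rewrite -vP.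
Qed.

Lemma tangent_vector_axiom x : vector_axiom_def n (tangent x).
Proof.
exists (fun v : tangent x => v (charts_at_chosen x)); first by [].
exists (tangent_of (charts_at_chosen x)).
  exact: tangent_coordK.
exact: tangent_ofK.
Qed.

HB.instance Definition _ x :=
  Lmodule_hasFinDim.Build R (tangent x) (tangent_vector_axiom x).

(* Extended by 0 outside the domain of phi. *)
Definition coord_field (phi : chart R n M) (i : 'I_n) x : tangent x :=
  if pselect (phi \in charts_at x) is left phix
  then tangent_of (SigSub phix) (delta_mx 0 i) else 0.

End TangentSpace.
Arguments tangent {R n} M x.

Definition form_field (R : realType) (n : nat) (M : smooth_manifold R n)
  (p : nat) := forall x : M, altform (tangent M x) p.

Section Forms.
Context {R : realType} {n : nat} {M : smooth_manifold R n}.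

Definition smooth_form p (a : form_field M p) : Prop :=
  forall phi, atlas phi -> forall I : 'I_p -> 'I_n,
  smooth_on (phi @` chart_dom phi)
    (fun y => let x := chart_inv phi y in
              a x (fun k => coord_field phi (I k) x) : R^o).

Definition wedge_form p q (a : form_field M p) (b : form_field M q) :
  form_field M (p + q) := fun x => wedge (a x) (b x).

Definition almost_multisymplectic p (a : form_field M p.+1) : Prop :=
  forall x, injective (fun v : tangent M x => intprod v (a x)).

Definition nowhere_vanishing p (a : form_field M p) : Prop :=
  forall x, a x != 0.

Definition pair_class (tau : form_field M 1) (omega : form_field M 2) (x : M) :
  nat := codim (Ker (tau x) :&: Ker (omega x)).

Definition ext_char_distribution (tau : form_field M 1)
    (omega : form_field M 2) (x : M) : set (tangent M x) :=
  [set v | v \in Ker (tau x) /\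
           exists a : R, intprod v (omega x) = a *: tau x].

End Forms.
Arguments ext_char_distribution {R n M} tau omega x.

(* Main.v *)
Require Import Defs.
From HB Require Import structures.
From mathcomp Require Import all_boot all_order all_algebra fingroup perm.
From mathcomp Require Import all_classical all_reals all_analysis.
From mathcomp Require Import ring.

Set Implicit Arguments.
Unset Strict Implicit.
Unset Printing Implicit Defensive.

Import GRing.Theory Num.Theory.

(** The three conditions are compared at one point at a time, so the theorem is
linear algebra on a finite-dimensional space V with a 1-form tau and a 2-form
omega for which Ker tau and Ker omega meet in codimension at least 3. The
contraction of the wedge product is
[[
  i_x (tau /\ omega) = tau(x) omega - tau /\ (i_x omega),
]]
read off from the expansion of a wedge with a 1-form along its first slot
([wedge1E], [intprod_wedge_eq0]).

If contraction is injective, then tau <> 0 because V <> 0; and when tau(x) = 0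
and i_x omega = a tau, the contraction by x is - a tau /\ tau = 0, so x = 0
([wedge_inj_ext_char]).

Suppose next that tau <> 0 and the extended characteristic space is zero. It
contains the meet of Ker tau and Ker omega, so the class is dim V. A vector of
the hyperplane Ker tau that is omega-orthogonal to the whole hyperplane has
i_x omega proportional to tau, hence is 0: omega is nondegenerate on Ker tau.
A skew matrix of odd size is singular ([odd_dim_degenerate]), so Ker tau has
even dimension and dim V is odd ([ext_char_odd]).

Finally let dim V be odd and the two kernels meet in 0. The same fact about odd
size gives r <> 0 in Ker omega, and tau(r) <> 0. If i_x (tau /\ omega) = 0,
evaluating at (r, z) gives tau(r) omega(x, z) = 0, so x lies in Ker omega, and
what remains is tau(x) omega = 0. Were tau(x) <> 0, omega would vanish and
Ker tau, a hyperplane, would be 0, contradicting dim V >= 3; so x = 0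
([odd_wedge_inj]). *)

Local Open Scope classical_set_scope.
Local Open Scope ring_scope.

(** * Permuting arguments, and the wedge with a 1-form *)

Section Antisymmetry.
Context {R : numFieldType} {V : lmodType R}.

Lemma altformD p (a : altform V p) (v : 'I_p -> V) i x y :
  a [eta v with i |-> x + y] = a [eta v with i |-> x] + a [eta v with i |-> y].
Proof. by have := altform_multilinear a i v 1 x y; rewrite /= !scale1r. Qed.

(** Polarization: expand the vanishing value of [a] on two equal arguments
v_i + v_j. *)
Lemma altform_tperm p (a : altform V p) (v : 'I_p -> V) (i j : 'I_p) :
  i != j -> a (fun k => v (tperm i j k)) = - a v.
Proof.
move=> ij.
(* w x y carries x in slot i and y in slot j *)
pose w x y : 'I_p -> V := [eta [eta v with i |-> x] with j |-> y].
have wC x y : w x y = [eta [eta v with j |-> y] with i |-> x].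
  apply/funext => k; rewrite /w /=.
  by case: eqP => [->|//]; rewrite eq_sym (negPf ij).
have w0 x : a (w x x) = 0.
  by apply: (@altform_alternate _ _ _ a _ i j ij); rewrite /w /= (negPf ij) !eqxx.
have := w0 (v i + v j).
rewrite {1}/w altformD -/(w _ _) -/(w _ _) !wC !altformD -!wC !w0 add0r addr0.
have -> : w (v i) (v j) = v.
  by apply/funext => k; rewrite /w /=; do 2 case: eqP => [->|_] //.
have -> : w (v j) (v i) = fun k => v (tperm i j k).
  apply/funext => k; rewrite /w /=.
  case: tpermP => [->|->|/eqP/negPf -> /eqP/negPf -> //].
    by rewrite (negPf ij) eqxx.
  by rewrite eqxx.
by move/eqP; rewrite addr_eq0 => /eqP.
Qed.

Lemma altform_perm p (a : altform V p) (s : 'S_p) (v : 'I_p -> V) :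
  a (fun k => v (s k)) = (-1) ^+ s * a v :> R.
Proof.
case: (prod_tpermP s) => ts ->; elim: ts v => [|[i j] ts IH] v /=.
  move=> _; rewrite big_nil odd_perm1 mul1r.
  by congr (altform_fun _ _); apply/funext => k; rewrite perm1.
move=> /andP[ij /IH{}IH]; rewrite big_cons /= odd_permM odd_tperm ij signr_addb.
rewrite -mulrA -IH mulN1r -(altform_tperm _ _ ij).
by congr (altform_fun _ _); apply/funext => k; rewrite permM.
Qed.

(** A permutation of q + 1 points is determined by the image of 0 and a
permutation of the other q points; counting makes injectivity enough. *)
Lemma lift_perm_bij q :
  bijective (fun u : 'I_q.+1 * 'S_q => lift_perm ord0 u.1 u.2).
Proof.
apply: inj_card_bij; last by rewrite card_prod !card_Sn card_ord factS.
move=> [i s] [j t] /= E.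
have ij : i = j by rewrite -(lift_perm_id ord0 i s) E lift_perm_id.
rewrite -{}ij in E *; congr (_, _); apply/permP => k.
by apply: (@lift_inj _ i); rewrite -!(lift_perm_lift ord0) E.
Qed.

(** Group the permutations s by i = s 0. Antisymmetry of [b] makes the q! terms
of each group equal, which cancels the normalizing factor. *)
Lemma wedge1E q (a : altform V 1) (b : altform V q) (v : 'I_q.+1 -> V) :
  wedge a b v = \sum_(i < q.+1)
    (-1) ^+ i * (a (fun=> v i) : R) * (b (fun k => v (lift i k)) : R) :> R.
Proof.
rewrite /= /wedge_fun mul1n (reindex _ (onW_bij _ (lift_perm_bij q))) /=.
have E (i : 'I_q.+1) (s : 'S_q) : (-1) ^+ (lift_perm ord0 i s) *
    ((a (fun k => v (lift_perm ord0 i s (lshift q k))) : R) *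
     (b (fun k => v (lift_perm ord0 i s (rshift 1 k))) : R)) =
    (-1) ^+ i * (a (fun=> v i) : R) * (b (fun k => v (lift i k)) : R).
  have -> : (fun k : 'I_1 => v (lift_perm ord0 i s (lshift q k))) = fun=> v i.
    apply/funext => k; rewrite -[in RHS](lift_perm_id ord0 i s).
    by congr (v (lift_perm _ _ _ _)); apply: val_inj; rewrite /= ord1.
  have -> : (fun k : 'I_q => v (lift_perm ord0 i s (rshift 1 k))) =
            fun k => v (lift i (s k)).
    apply/funext => k; rewrite -(lift_perm_lift ord0 i s k).
    by congr (v (lift_perm _ _ _ _)); apply: val_inj.
  rewrite (altform_perm b s (fun k => v (lift i k))) odd_lift_perm /=.
  rewrite signr_addb signr_odd -!mulrA; congr (_ * _).
  rewrite mulrCA; congr (_ * _).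
  by rewrite mulrA -signr_addb addbb mul1r.
rewrite (eq_bigr _ (fun u _ => E u.1 u.2)) -(pair_bigA _ (fun (i : 'I_q.+1) (_ : 'S_q) =>
  (-1) ^+ i * (a (fun=> v i) : R) * (b (fun k => v (lift i k)) : R))) /=.
under eq_bigr => i _ do rewrite sumr_const card_Sn -mulr_natl.
by rewrite -mulr_sumr mulrA mulVf ?mul1r // pnatr_eq0 -lt0n fact_gt0.
Qed.

End Antisymmetry.

(** * Forms of degree 1 and 2 as functions of vectors *)

Section Values.
Context {R : numFieldType} {V : vectType R}.
Implicit Types (tau : altform V 1) (omega : altform V 2) (x y z : V).

(** [val1] and [val2] replace families indexed by finite ordinals by plain
vectors, which gives access to the theory of linear functions. *)
Definition val1 tau x : R := tau (fun=> x).

Lemma val1_linear tau : linear_for *%R (val1 tau).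
Proof.
move=> c x y; have E z : val1 tau z = tau [eta (fun=> 0) with ord0 |-> z].
  by congr (altform_fun _ _); apply/funext => k; rewrite (ord1 k).
by rewrite !E altform_multilinear.
Qed.

HB.instance Definition _ tau :=
  GRing.isLinear.Build R V R _ (val1 tau) (val1_linear tau).

Lemma val1E tau (v : 'I_1 -> V) : tau v = val1 tau (v ord0).
Proof. by congr (altform_fun _ _); apply/funext => k; rewrite (ord1 k). Qed.

Lemma val1_inj : injective val1.
Proof.
move=> tau tau' E; apply/val_inj/funext => v.
by rewrite -[LHS]/(tau v) -[RHS]/(tau' v) !val1E E.
Qed.

Definition val2 omega x y : R := val1 (intprod x omega) y.

HB.instance Definition _ omega x :=
  GRing.isLinear.Build R V R _ (val2 omega x) (val1_linear (intprod x omega)).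

Lemma val2E omega (v : 'I_2 -> V) : omega v = val2 omega (v ord0) (v ord_max).
Proof.
congr (altform_fun _ _); apply/funext => k; rewrite /consv.
case: (unliftP ord0 k) => [k' ->|-> //] /=; rewrite (ord1 k').
by congr v; apply: val_inj.
Qed.

Lemma val2_alt omega x : val2 omega x x = 0.
Proof.
apply: (@altform_alternate _ _ _ omega _ ord0 (lift ord0 ord0)) => //.
by rewrite /consv unlift_none liftK.
Qed.

Lemma val2C omega x y : val2 omega y x = - val2 omega x y.
Proof.
have D u v w : val2 omega (u + v) w = val2 omega u w + val2 omega v w.
  by have := intprod_linear omega 1 u v; rewrite !scale1r /val2 => ->.
have := val2_alt omega (x + y); rewrite D !linearD /= !val2_alt add0r addr0.
by rewrite addrC => /eqP; rewrite addr_eq0 => /eqP.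
Qed.

Lemma mem_Ker1 tau x : x \in Ker tau <-> val1 tau x = 0.
Proof.
rewrite mem_Ker; split=> [E|E].
  have /= E' := congr1 (fun a : altform V 0 => a (fun=> x)) E.
  by rewrite -[RHS]E' /intprod_fun val1E /consv unlift_none.
by apply/val_inj/funext => v; rewrite /= /intprod_fun val1E /consv unlift_none.
Qed.

Lemma mem_Ker2 omega x : x \in Ker omega <-> forall y, val2 omega x y = 0.
Proof.
rewrite mem_Ker; split=> [E y|E]; first by rewrite /val2 E.
by apply: val1_inj; apply/funext => y; rewrite -/(val2 omega x y) E.
Qed.

Lemma intprod_wedge_eq0 tau omega x :
  intprod x (wedge tau omega : altform V 3) = 0 <->
  forall y z, val1 tau x * val2 omega y z - val1 tau y * val2 omega x z
              + val1 tau z * val2 omega x y = 0.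
Proof.
have E (v : 'I_2 -> V) : intprod x (wedge tau omega : altform V 3) v =
    val1 tau x * val2 omega (v ord0) (v ord_max)
    - val1 tau (v ord0) * val2 omega x (v ord_max)
    + val1 tau (v ord_max) * val2 omega x (v ord0) :> R.
  rewrite [LHS](wedge1E tau omega (consv x v)) !big_ord_recl big_ord0 !val2E.
  have c0 : consv x v ord0 = x by rewrite /consv unlift_none.
  have c1 (k : 'I_3) : k = 1%N :> nat -> consv x v k = v ord0.
    move=> k1; rewrite (_ : k = lift ord0 ord0); last exact: val_inj.
    by rewrite /consv liftK.
  have c2 (k : 'I_3) : k = 2%N :> nat -> consv x v k = v ord_max.
    move=> k2; rewrite (_ : k = lift ord0 ord_max); last exact: val_inj.
    by rewrite /consv liftK.
  rewrite -!/(val1 _ _) c0 !(c1 (lift ord0 ord0)) // (c2 (lift ord0 ord_max)) //.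
  rewrite (c2 (lift ord0 (lift ord0 ord0))) //.
  rewrite (c2 (lift (lift ord0 ord0) ord_max)) //.
  rewrite (_ : lift (lift ord0 ord0) ord0 = ord0); last exact: val_inj.
  rewrite (_ : lift (lift ord0 (lift ord0 ord0)) ord0 = ord0); last exact: val_inj.
  rewrite (c1 (lift (lift ord0 (lift ord0 ord0)) ord_max)) // c0.
  by rewrite /= /bump /=; ring.
split=> [x0 y z|x0].
  have := E (consv y (fun=> z)); rewrite x0 /consv unlift_none.
  by rewrite (_ : ord_max = lift ord0 ord0) ?liftK //; exact: val_inj.
by apply/val_inj/funext => v; rewrite -[LHS]/(altform_fun _ v) E x0.
Qed.

(** The Gram matrix A of omega on U satisfies A^T = - A, so in odd size
det A = - det A; a row vector killed by A gives the coordinates of x. *)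
Lemma odd_dim_degenerate omega (U : {vspace V}) : odd (\dim U) ->
  exists2 x, x \in U /\ x != 0 & forall y, y \in U -> val2 omega x y = 0.
Proof.
move=> oddU; pose e := vbasis U.
pose A : 'M[R]_(\dim U) := \matrix_(i, j) val2 omega (e`_i) (e`_j).
have /det0P[w w0 wA] : \det A == 0.
  have : A^T = - A by apply/matrixP => i j; rewrite !mxE val2C.
  move/(congr1 determinant); rewrite det_tr -scaleN1r detZ -signr_odd oddU mulN1r.
  by move/eqP; rewrite -addr_eq0 -mulr2n mulrn_eq0.
exists (\sum_i w 0 i *: e`_i); first split.
- apply: memv_suml => i _; apply/memvZ/vbasis_mem/mem_nth.
  by rewrite size_tuple.
- have /freeP eP := basis_free (vbasisP U).
  apply: contraNneq w0 => /(eP (fun i => w 0 i)) E.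
  by apply/eqP/rowP => i; rewrite mxE E.
move=> y /coord_vbasis ->; rewrite linear_sum big1 // => j _; rewrite linearZ /=.
suff -> : val2 omega (\sum_i w 0 i *: e`_i) e`_j = 0 by rewrite mulr0.
transitivity ((w *m A) 0 j); last by rewrite wA mxE.
rewrite val2C linear_sum -sumrN mxE; apply: eq_bigr => i _.
by rewrite linearZ /= -mulrN -val2C mxE.
Qed.

Lemma neq0_val1 tau : tau != 0 -> exists r, val1 tau r != 0.
Proof.
move=> tau0; apply: contrapT => /forallNP E; case/negP: tau0; apply/eqP.
by apply: val1_inj; apply/funext => x; have /negP/negPn/eqP := E x.
Qed.

(** Any r with tau r <> 0 spans a line complementary to the kernel. *)
Lemma dim_Ker1 tau : tau != 0 -> \dim {:V} = (\dim (Ker tau)).+1.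
Proof.
move=> /neq0_val1[r r0].
have r_neq0 : r != 0 by apply: contraNneq r0 => ->; rewrite linear0.
have capE : (Ker tau :&: <[r]> = 0)%VS.
  apply/eqP; rewrite -subv0; apply/subvP => x /memv_capP[/mem_Ker1 + /vlineP[c xE]].
  rewrite xE linearZ /= => /eqP; rewrite mulf_eq0 (negPf r0) orbF => /eqP ->.
  by rewrite scale0r mem0v.
have -> : fullv = (Ker tau + <[r]>)%VS.
  apply/esym/vspaceP => x; rewrite memvf.
  rewrite -(subrK ((val1 tau x / val1 tau r) *: r) x).
  rewrite memv_add ?memvZ ?memv_line //; apply/mem_Ker1.
  by rewrite linearB linearZ /= divfK ?subrr.
by rewrite dimv_disjoint_sum // dim_vline r_neq0 addn1.
Qed.

End Values.

(** * The three implications at a point *)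

Section Pointwise.
Context {R : numFieldType} {V : vectType R}.
Variables (tau : altform V 1) (omega : altform V 2).

Lemma wedge_inj_ext_char : (0 < \dim {:V})%N ->
    injective (fun x => intprod x (wedge tau omega : altform V 3)) ->
  tau != 0 /\
  forall x, x \in Ker tau -> (exists a, intprod x omega = a *: tau) -> x = 0.
Proof.
move=> V0 inj.
have inj0 x : intprod x (wedge tau omega : altform V 3) = 0 -> x = 0.
  move=> x0; apply: inj; rewrite x0; apply/esym/intprod_wedge_eq0 => y z.
  rewrite linear0 !(val2C _ _ 0) !linear0; ring.
split=> [|x /mem_Ker1 tx [a xE]].
  apply: contraTneq V0 => tau0; rewrite -leqNgt leqn0 dimv_eq0 -subv0.
  apply/subvP => x _; rewrite memv0; apply/eqP/inj0/intprod_wedge_eq0 => y z.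
  by rewrite tau0 /val1 /= !mul0r subr0 addr0.
apply/inj0/intprod_wedge_eq0 => y z.
have E t : val2 omega x t = a * val1 tau t by rewrite /val2 xE.
by rewrite tx !E; ring.
Qed.

Lemma ext_char_odd : tau != 0 ->
    (forall x, x \in Ker tau -> (exists a, intprod x omega = a *: tau) -> x = 0) ->
  odd (\dim {:V}) /\ (Ker tau :&: Ker omega = 0)%VS.
Proof.
move=> tau0 X0; split; last first.
  apply/eqP; rewrite -subv0; apply/subvP => x /memv_capP[tx /mem_Ker ox].
  by rewrite memv0; apply/eqP/X0 => //; exists 0; rewrite scale0r.
rewrite (dim_Ker1 tau0) //=; apply/negP => /(odd_dim_degenerate omega)[x [xK x0] ox].
case/eqP: x0; apply: X0 => //.
have [r r0] := neq0_val1 tau0.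
(* the factor is forced by evaluating i_x omega = a tau at r *)
exists (val2 omega x r / val1 tau r); apply: val1_inj; apply/funext => y.
have : val2 omega x (y - (val1 tau y / val1 tau r) *: r) = 0.
  by apply/ox/mem_Ker1; rewrite linearB linearZ /= divfK ?subrr.
rewrite linearB linearZ /= => /eqP; rewrite subr_eq0 => /eqP E.
rewrite -[LHS]/(val2 omega x y) E -[RHS]/(_ * val1 tau y).
by rewrite mulrC mulrA mulrAC.
Qed.

Lemma odd_wedge_inj : odd (\dim {:V}) -> (Ker tau :&: Ker omega = 0)%VS ->
    (1 < \dim {:V})%N ->
  injective (fun x => intprod x (wedge tau omega : altform V 3)).
Proof.
move=> oddV cap0 V1.
have capP x : val1 tau x = 0 -> (forall y, val2 omega x y = 0) -> x = 0.
  move=> tx ox; apply/eqP; rewrite -memv0 -cap0; apply/memv_capP.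
  by split; [apply/mem_Ker1|apply/mem_Ker2].
have [r [_ r_neq0] or] := odd_dim_degenerate omega oddV.
have {}or y : val2 omega r y = 0 by apply: or; rewrite memvf.
have tr : val1 tau r != 0 by apply: contraNneq r_neq0 => /capP ->.
suff inj0 x : intprod x (wedge tau omega : altform V 3) = 0 -> x = 0.
  move=> x y /= E; apply/eqP; rewrite -subr_eq0; apply/eqP/inj0.
  by rewrite addrC -scaleN1r intprod_linear E scaleN1r addNr.
move=> /intprod_wedge_eq0 x0.
have ox z : val2 omega x z = 0.
  have := x0 r z; rewrite (val2C _ r x) !or oppr0 !mulr0 sub0r addr0 => /eqP.
  by rewrite oppr_eq0 mulf_eq0 (negPf tr) => /eqP.
apply: (capP) => //; apply/eqP; apply: contraTT V1 => tx.
have o0 y z : val2 omega y z = 0.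
  have := x0 y z; rewrite !ox !mulr0 subr0 addr0 => /eqP.
  by rewrite mulf_eq0 (negPf tx) => /eqP.
rewrite (@dim_Ker1 _ _ tau); last by apply: contraNneq tx => ->.
rewrite -leqNgt ltnS leqn0 dimv_eq0 -subv0; apply/subvP => y /mem_Ker1 ty.
by rewrite memv0; apply/eqP/capP.
Qed.

End Pointwise.

Theorem corollary3p14 (R : realType) (n : nat) (M : smooth_manifold R n)
    (tau : form_field M 1) (omega : form_field M 2)
    (M_nonempty : [set: M] !=set0)
    (tau_smooth : smooth_form tau) (omega_smooth : smooth_form omega)
    (class_ge3 : forall x : M, (3 <= pair_class tau omega x)%N) :
  [<-> almost_multisymplectic (wedge_form tau omega);
       nowhere_vanishing tau /\
         (forall x : M, ext_char_distribution tau omega x = [set 0]);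
       odd n /\ (forall x : M, pair_class tau omega x = n)].
Proof.
have dimT (x : M) : \dim {:tangent M x} = n by rewrite dimvf.
have n3 : (3 <= n)%N.
  have [x _] := M_nonempty; apply: leq_trans (class_ge3 x) _.
  by rewrite /pair_class /codim dimT leq_subr.
tfae.
- move=> inj; have dimT_gt0 x : (0 < \dim {:tangent M x})%N.
    by rewrite dimT ltnW // ltnW.
  have H x := wedge_inj_ext_char (dimT_gt0 x) (inj x).
  split=> [x|x]; first by case: (H x).
  apply/seteqP; split=> [v [vK vE]|v ->] /=; first exact: (H x).2.
  split; first exact: mem0v.
  exists 0; rewrite scale0r.
  by apply/mem_Ker; rewrite mem0v.
- move=> [tau0 X0].
  have H x : odd (\dim {:tangent M x}) /\ (Ker (tau x) :&: Ker (omega x) = 0)%VS.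
    apply: ext_char_odd (tau0 x) _ => v vK vE.
    have : ext_char_distribution tau omega x v by [].
    by rewrite X0.
  split=> [|x]; first by have [x _] := M_nonempty; case: (H x); rewrite dimT.
  by rewrite /pair_class /codim (H x).2 dimv0 dimT subn0.
- move=> [oddn cl] x; apply: odd_wedge_inj.
  + by rewrite dimT.
  + apply/eqP; rewrite -dimv_eq0; apply/eqP.
    have := cl x; rewrite /pair_class /codim dimT => E.
    have := dimvS (subvf (Ker (tau x) :&: Ker (omega x))); rewrite dimT => dn.
    by apply: (@addnI n); rewrite addn0 -{1}E subnK.
  + by rewrite dimT ltnW.
Qed.
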